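(* Let $k\ge 2$ be an integer and set $\mathcal{P}_k=\{p \text{ prime}: (p-1)\mid (k-1)\}$ and $M_k=\prod_{p\in\mathcal{P}_k}p$. If integers $a,b,c,d$ satisfy $a^k+b^k=c^k+d^k$ and $h=(c+d)-(a+b)$, then $M_k\mid h$. *)

(* Defs.v *)
From mathcomp Require Import all_boot all_order all_algebra.

Set Implicit Arguments.
Unset Strict Implicit.
Unset Printing Implicit Defensive.

Definition Pset (k : nat) : pred nat :=
  fun p => prime p && (p - 1 %| k - 1).

(* For k >= 2 every member of Pset k is at most k (Pset_le below), so the
   bound p < k.+1 only makes the finite index range explicit. *)
Definition Mprod (k : nat) : nat := \prod_(0 <= p < k.+1 | Pset k p) p.

Lemma Pset_le (k p : nat) : 2 <= k -> Pset k p -> p < k.+1.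
Proof.
move=> k2 /andP[_ /dvdn_leq le].
have k1 : 0 < k - 1 by rewrite subn_gt0.
by have := le k1; rewrite leq_subLR subnKC ?(ltnW k2).
Qed.

(* Main.v *)
Require Import Defs.
From mathcomp Require Import all_boot all_order all_algebra.
From mathcomp Require Import finfield.
Import GRing.Theory Num.Theory.
Local Open Scope ring_scope.

(* For p in P_k, Fermat's little theorem makes x |-> x ^ k the identity of F_p,
   so the equation a^k + b^k = c^k + d^k reduces to a + b = c + d modulo p.
   Distinct primes being coprime, their product M_k divides h as well. *)

(** Fermat is used as [x ^+ (p - 1) * x = x], which covers [x = 0] too. As [k = m * (p - 1) + 1],
    induction on [m] lets the last factor [x] absorb each block of [p - 1] factors. *)
Lemma Fp_exp_id (p k : nat) (x : 'F_p) :
  prime p -> (0 < k)%N -> (p - 1 %| k - 1)%N -> x ^+ k = x.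
Proof.
move=> p_pr k_gt0 /dvdnP[m def_k].
have xp : x ^+ (p - 1) * x = x.
  rewrite -exprSr subn1 prednK ?prime_gt0 //.
  by rewrite -[X in _ ^+ X](card_Fp p_pr) expf_card.
rewrite -(subnK k_gt0) def_k {k k_gt0 def_k}.
elim: m => [|m IHm]; first by rewrite mul0n expr1.
by rewrite mulSn -addnA exprD IHm.
Qed.

Lemma dvdn_prod_primes (s : seq nat) (n : nat) :
  uniq s -> {in s, forall p, prime p /\ (p %| n)%N} -> (\prod_(p <- s) p %| n)%N.
Proof.
elim: s => [|q s IHs] /=; first by rewrite big_nil dvd1n.
case/andP=> q_notin s_uniq s_dvd; rewrite big_cons.
have [q_pr q_dvd] := s_dvd q (mem_head q s).
have {}s_dvd : {in s, forall p, prime p /\ (p %| n)%N}.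
  by move=> p p_s; apply: s_dvd; rewrite inE p_s orbT.
rewrite Gauss_dvd ?q_dvd ?IHs // big_seq.
(* Coprimality to [q] passes to products, so it is enough to check the single primes of [s], which
   differ from [q] by uniqueness. *)
apply: (big_ind (coprime q)) => [|x y|p p_s]; first exact: coprimen1.
  by rewrite coprimeMr => -> ->.
have [p_pr _] := s_dvd p p_s.
by rewrite prime_coprime // dvdn_prime2 //; apply: contraNneq q_notin => ->.
Qed.

Theorem theorem4p1 (k : nat) (hk : (2 <= k)%N) (a b c d h : int)
  (habcd : a ^+ k + b ^+ k = c ^+ k + d ^+ k)
  (hh : h = (c + d) - (a + b)) :
  ((Mprod k)%:Z %| h)%Z.
Proof.
rewrite dvdzE /= /Mprod -big_filter.
apply: dvdn_prod_primes => [|p]; first by rewrite filter_uniq ?iota_uniq.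
rewrite mem_filter => /andP[/andP[p_pr p_dvd] _]; split=> //.
have -> : (p %| `|h|)%N = (p%:Z %| h)%Z by rewrite dvdzE.
(* ['F_p] has characteristic [p], so [p] divides [h] exactly when the image of [h] in ['F_p]
   vanishes. *)
rewrite (dvdz_pcharf (pchar_Fp p_pr)) hh rmorphB /= subr_eq0; apply/eqP.
have /(congr1 (fun z : int => z%:~R : 'F_p)) := habcd.
by rewrite !rmorphD /= !rmorphXn /= !(Fp_exp_id p k _ p_pr (ltnW hk) p_dvd) => ->.
Qed.
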